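(* Let $Y$ be a metrizable uniform space and let $B\subset Y$ be a subset. Let $X$ and $A\subset X$ be uniform ARs [respectively, uniform ANRs]. Then $U((Y,B),(X,A))$ is a uniform AR [respectively, a uniform ANR].
   Context: A uniform AR [uniform ANR] is a metrizable uniform space $P$ such that for every uniform embedding $i$ of $P$ onto a closed subspace of a metrizable uniform space $Z$ there exists a uniformly continuous retraction of $Z$ [respectively, of some uniform neighborhood of $i(P)$ in $Z$, i.e. a set containing an $\varepsilon$-neighborhood of $i(P)$ for some $\varepsilon>0$] onto $i(P)$. The subset $A$ carries the subspace uniformity; it is not assumed closed in $X$, and $B$ is not assumed closed in $Y$. $U(Y,X)$ is the space of all uniformly continuous maps $Y\to X$ with the uniformity of uniform convergence, i.e. induced by $d(f,g)=\sup_{y\in Y}d(f(y),g(y))$ where $d$ is a bounded metric inducing the uniformity of $X$. $U((Y,B),(X,A))$ is the subspace of $U(Y,X)$ consisting of the maps that send $B$ into $A$. *)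

(* Defs.v *)
From HB Require Import structures.
From mathcomp Require Import all_boot all_order all_algebra.
From mathcomp Require Import all_classical all_reals topology.

Set Implicit Arguments.
Unset Strict Implicit.
Unset Printing Implicit Defensive.

Import Order.TTheory GRing.Theory Num.Theory.

Local Open Scope classical_set_scope.
Local Open Scope ring_scope.

(* A set [S : set T] used as a type is [set_type S]; the library gives it the
   subspace uniformity, i.e. the initial one along [set_val]. *)

Definition metrizes (R : realType) (T : uniformType) (d : T -> T -> R) : Prop :=
  [/\ forall x, d x x = 0,
      forall x y, d x y = 0 -> x = y,
      forall x y, d x y = d y x,
      forall x y z, d x z <= d x y + d y z
    & @entourage T = entourage_ (fun (x : T) (e : R) => [set y | d x y < e])].

Definition metrizable (R : realType) (T : uniformType) : Prop :=
  exists d : T -> T -> R, metrizes d.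

(* The map [g] is the inverse of [i] on its image. *)
Definition uniform_embedding (P Z : uniformType) (i : P -> Z) : Prop :=
  [/\ injective i, unif_continuous i
    & exists g : range i -> P,
        unif_continuous g /\ forall z : range i, i (g z) = set_val z].

(* The choice of the metric [d] is immaterial, since any two metrics inducing
   the uniformity of [Z] are uniformly equivalent. *)
Definition uniform_nbhd (R : realType) (Z : uniformType) (S N : set Z) : Prop :=
  exists2 d : Z -> Z -> R, metrizes d &
    exists2 e : R, 0 < e & forall x z, S x -> d x z < e -> N z.

Definition uniform_AR (R : realType) (P : uniformType) : Prop :=
  metrizable R P /\
  forall (Z : uniformType) (i : P -> Z),
    metrizable R Z -> uniform_embedding i -> closed (range i) ->
    exists r : Z -> range i,
      unif_continuous r /\ forall s : range i, r (set_val s) = s.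

Definition uniform_ANR (R : realType) (P : uniformType) : Prop :=
  metrizable R P /\
  forall (Z : uniformType) (i : P -> Z),
    metrizable R Z -> uniform_embedding i -> closed (range i) ->
    exists N : set Z, uniform_nbhd R (range i) N /\
    exists r : N -> range i,
      unif_continuous r /\
      forall (x : N) (s : range i), set_val x = set_val s -> r x = s.

Definition unif_pair_maps (Y X : uniformType) (B : set Y) (A : set X) :
    set {uniform Y -> X} :=
  [set f | unif_continuous (f : Y -> X) /\ f @` B `<=` A].

(* U((Y, B), (X, A)) *)
Definition unif_pair_space (Y X : uniformType) (B : set Y) (A : set X) :
    uniformType :=
  set_type (unif_pair_maps B A).

(* The uniformity above is the one of the sup metric of any bounded metric
   inducing the uniformity of [X]. *)
Lemma unif_pair_space_sup_metric (R : realType) (Y X : uniformType)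
    (B : set Y) (A : set X) (d : X -> X -> R) (M : R) :
  metrizes d -> (forall x x', d x x' <= M) ->
  metrizes (fun f g : unif_pair_space B A =>
    sup (range (fun y : Y => d (set_val f y) (set_val g y)))).
Proof.
move=> [d0 dP dC dT dE] dM.
have dge0 x y : 0 <= d x y.
  by have := dT x y x; rewrite d0 (dC y x) -mulr2n pmulrn_lge0.
pose D (f g : unif_pair_space B A) :=
  sup (range (fun y : Y => d (set_val f y) (set_val g y))).
have ub f g : has_ubound (range (fun y : Y => d ((set_val f : Y -> X) y) ((set_val g : Y -> X) y))).
  by exists M => _ [y _ <-].
have leD (f g : unif_pair_space B A) y : d ((set_val f : Y -> X) y) ((set_val g : Y -> X) y) <= D f g.
  by apply: ub_le_sup; [exact: ub | exists y].
have Dle (f g : unif_pair_space B A) c : 0 <= c ->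
    (forall y, d ((set_val f : Y -> X) y) ((set_val g : Y -> X) y) <= c) -> D f g <= c.
  move=> c0 h; rewrite /D; have [->|/set0P ne] := eqVneq (range (fun y : Y => d (set_val f y) (set_val g y))) set0.
    by rewrite sup0.
  by apply: ge_sup => [//|_ [y _ <-]]; exact: h.
have Dge0 f g : 0 <= D f g.
  rewrite /D; have [->|/set0P [_ [y _ _]]] := eqVneq (range (fun y : Y => d (set_val f y) (set_val g y))) set0.
    by rewrite sup0.
  exact: le_trans (dge0 _ _) (leD f g y).
split.
- move=> f; apply/eqP; rewrite eq_le; apply/andP; split; last exact: Dge0.
  by apply: Dle => // y; rewrite d0.
- move=> f g fg; apply: val_inj; apply/funext => y; apply: dP.
  by apply/eqP; rewrite eq_le dge0 andbT -fg; exact: leD.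
- by move=> f g; congr sup; apply: eq_imagel => y _; rewrite dC.
- move=> f g h; apply: Dle => [|y]; first exact: (addr_ge0 (Dge0 _ _) (Dge0 _ _)).
  exact: le_trans (dT _ _ _) (lerD (leD _ _ _) (leD _ _ _)).
have entE : @entourage (unif_pair_space B A) =
    filter_from (@entourage {uniform Y -> X}) (fun V =>
      (fun xy => (set_val xy.1, set_val xy.2)) @^-1` V).
  by [].
rewrite entE; apply/seteqP; split => V.
- move=> [W + WV]; rewrite uniform_entourage => -[E + EW].
  rewrite dE => -[e e0 eE]; exists e => // -[f g] /= fge.
  apply: WV; apply: EW => y _; apply: eE => /=.
  exact: le_lt_trans (leD _ _ y) fge.
- move=> [e e0 eV].
  have e20 : 0 < e / 2 by rewrite divr_gt0.
  exists [set fg : {uniform Y -> X} * {uniform Y -> X} |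
    forall y, d ((fg.1 : Y -> X) y) ((fg.2 : Y -> X) y) < e / 2].
    rewrite uniform_entourage.
    exists [set xy | d xy.1 xy.2 < e / 2]; first by rewrite dE; exists (e / 2).
    by move=> fg /= h y; exact: h.
  move=> [f g] /= h; apply: eV => /=.
  apply: (@le_lt_trans _ _ (e / 2)); last first.
    by rewrite ltr_pdivrMr// ltr_pMr// ltr1n.
  by apply: Dle => [|y]; [exact: ltW | exact: ltW (h y)].
Qed.

(* Main.v *)
Require Import Defs.
From HB Require Import structures.
From mathcomp Require Import all_boot all_order all_algebra.
From mathcomp Require Import all_classical all_reals topology.
From mathcomp Require Import lra.

(** Let [U] be the space of maps of pairs, embedded as a closed subspace of [Z].
    A retraction assigns to every [z] a map [Y -> X] that is uniformly continuous
    in [y], and this assignment has to be uniformly continuous for the sup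
    metric, and to extend evaluation on [U]. The difficulty is that the members
    of [U] have no common modulus of continuity, so that evaluation is not
    uniformly continuous on [U * Y] and the extension properties of [X] and [A]
    do not apply to it directly. The retraction is built through functions.

    Let [d <= 1] be a metric of [X]. The Kuratowski embedding [x |-> d x] is an
    isometry of [X] into the functions from [X] to the unit interval with the sup
    metric. For such functions, evaluation has an explicit extension
    [G : Z -> Y -> (X -> R)], Lipschitz in [z] for a suitable metric of [Z]
    and uniformly continuous in [y] for each [z]: an infimum over McShane
    extensions with all Lipschitz constants [L] in the direction of [Y], with a
    penalty that makes large [L] unprofitable ([extension_lip],
    [extension_extends], [extension_unif]). The metric of [Z] is provided by
    [remetrize].

    It remains to come back from functions to [X]. Neither [X] nor [A] need be
    closed among the functions, so a height coordinate is added, and the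
    functions outside [X] are removed at height 0: the result is a metrizable
    space in which [X] is closed, and a uniform A(N)R structure gives a
    retraction of it, or of a collar of [X] in it ([uniform_AR_collar],
    [uniform_ANR_collar]). If [t] is the distance from [z] to [U], the point
    [(G z y, t)] belongs to this space, because [t = 0] only for [z] in [U].

    The maps obtained must also send [B] to [A]. For [y] in [B] the point
    [(G z y, t)] is in the cone of the points whose distance to [A] is at most
    their height, because [G] does not expand distances and [s y] is in [A] for
    [s] in [U]. So it is enough to have a retraction for [X] that sends the part
    of this cone of positive height into [A]. It is obtained from the retractions
    for [X] and for [A]: first push the cone to height 0 in [A], interpolating
    linearly with the identity next to the cone, and then retract to [X]
    ([pair_retraction_blend]). *)

Set Implicit Arguments.
Unset Strict Implicit.
Unset Printing Implicit Defensive.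

Import Order.TTheory GRing.Theory Num.Theory.

Local Open Scope classical_set_scope.
Local Open Scope ring_scope.

(** * Capped infima *)

Section CappedInfimum.
Context {R : realType}.
Implicit Types (S : set R) (k v : R).

Let carrier S := [set v : R | v = 1 \/ 0 <= v /\ S v].

(** The value 1 thrown into the set caps the infimum and settles the empty set,
    so that distances to a possibly empty set need no case distinction; negative
    members are discarded, so that every set has a lower bound. *)
Definition cinf S : R := inf (carrier S).

Let carrier_neq0 S : carrier S !=set0.
Proof. by exists 1; left. Qed.

Let carrier_lb S : has_lbound (carrier S).
Proof. by exists 0 => v [->|[]]. Qed.

Lemma cinf_ge0 S : 0 <= cinf S.
Proof. by apply: lb_le_inf => // v [->|[]]. Qed.

Lemma cinf_le1 S : cinf S <= 1.
Proof. by apply: ge_inf => //; left. Qed.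

Lemma cinf_le S v : 0 <= v -> S v -> cinf S <= v.
Proof. by move=> v0 Sv; apply: ge_inf => //; right. Qed.

Lemma cinf_ge S k : k <= 1 -> (forall v, 0 <= v -> S v -> k <= v) ->
  k <= cinf S.
Proof. by move=> k1 kS; apply: lb_le_inf => // v [->|[/kS]]//; apply. Qed.

Lemma cinf_lt S k : k <= 1 -> cinf S < k -> exists2 v, 0 <= v & S v /\ v < k.
Proof.
move=> k1 /inf_lt[//|v [->|[v0 Sv] vk]]; first by rewrite ltNge k1.
by exists v.
Qed.

Lemma cinf_add S1 S2 S3 :
  (forall v w, 0 <= v -> S1 v -> 0 <= w -> S2 w ->
    exists2 u, 0 <= u & S3 u /\ u <= v + w) ->
  cinf S3 <= cinf S1 + cinf S2.
Proof.
move=> h; rewrite -lerBlDl; apply: lb_le_inf => // w Hw.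
rewrite lerBlDl -lerBlDr; apply: lb_le_inf => // v Hv; rewrite lerBlDr.
have v0 : 0 <= v by case: Hv => [->|[]].
have w0 : 0 <= w by case: Hw => [->|[]].
have := cinf_le1 S3.
case: Hv Hw => [->|[_ Sv]] [->|[_ Sw]] c1; try lra.
have [u u0 [Su uvw]] := h _ _ v0 Sv w0 Sw.
exact: le_trans (cinf_le u0 Su) uvw.
Qed.

(** Comparison of two infima through near-optimal members; with [k] a distance
    between parameters it gives the Lipschitz bounds for all the functions
    defined below as infima. *)
Lemma cinf_shift S1 S2 k : 0 <= k ->
  (forall v, 0 <= v -> S1 v -> exists2 w, 0 <= w & S2 w /\ w <= v + k) ->
  cinf S2 <= cinf S1 + k.
Proof.
move=> k0 h; rewrite -lerBlDr; apply: lb_le_inf => // v Hv; rewrite lerBlDr.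
have := cinf_le1 S2.
case: Hv => [->|[v0 Sv]] c1; first lra.
have [w w0 [Sw wv]] := h _ v0 Sv.
exact: le_trans (cinf_le w0 Sw) wv.
Qed.

End CappedInfimum.

(** * Pseudometrics and uniform closeness of functions *)

Section PseudoMetric.
Context {R : realType}.

Definition pseudo_metric (T : Type) (d : T -> T -> R) :=
  [/\ forall x, d x x = 0, forall x y, d x y = d y x
    & forall x y z, d x z <= d x y + d y z].

Lemma pseudo_metric_ge0 (T : Type) (d : T -> T -> R) :
  pseudo_metric d -> forall x y, 0 <= d x y.
Proof.
move=> [d0 dC dT] x y; have := dT x y x; rewrite d0 (dC y x) => h; lra.
Qed.

Lemma metrizes_pseudo_metric (T : uniformType) (d : T -> T -> R) :
  metrizes d -> pseudo_metric d.
Proof. by case. Qed.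

Definition uclose (X : Type) (k : R) (e e' : X -> R) :=
  forall x, `|e x - e' x| <= k.

Lemma ucloseP (X : Type) (k : R) (e e' : X -> R) :
  uclose k e e' <-> forall x, e x <= e' x + k /\ e' x <= e x + k.
Proof.
split=> h x; have := h x; rewrite ler_norml => h'; last by apply/andP; lra.
by move/andP: h' => h'; lra.
Qed.

End PseudoMetric.

(** * Extension into a space of bounded functions *)

Section Extension.
Context {R : realType} {Y Z I X : Type}.
Variables (dY : Y -> Y -> R) (dZ : Z -> Z -> R) (i : I -> Z).
Variable g : I -> Y -> X -> R.
Hypothesis dYP : pseudo_metric dY.
Hypothesis dZP : pseudo_metric dZ.
Hypothesis g01 : forall s y x, 0 <= g s y x <= 1.
Hypothesis g_lip : forall s s' y, uclose (dZ (i s) (i s')) (g s y) (g s' y).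
Hypothesis g_unif : forall s e, 0 < e ->
  exists2 r, 0 < r & forall y y', dY y y' < r -> uclose e (g s y) (g s y').

(** Every bounded uniformly continuous function is Lipschitz up to an additive
    error, which tends to 0 as the Lipschitz constant [L] grows. The pairs
    [(L, c)] admissible for [s] replace a modulus of continuity of [g s]. *)
Definition lip_defect s (L c : R) :=
  [/\ 0 <= L, 0 <= c &
      forall y y' x, g s y x <= g s y' x + L * dY y y' + c].

Let lip_defect_ex s e : 0 < e -> exists L, lip_defect s L e.
Proof.
move=> e0; have [r r0 rg] := g_unif s e0.
exists r^-1; split; [by rewrite invr_ge0 ltW|exact: ltW|move=> y y' x].
have [/rg /ucloseP /(_ x)[h _]|h] := ltP (dY y y') r.
  have : 0 <= r^-1 * dY y y'.
    by rewrite mulr_ge0 ?(pseudo_metric_ge0 dYP)// invr_ge0 ltW.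
  lra.
have /andP[h1 _] := g01 s y' x; have /andP[_ h2] := g01 s y x.
have : 1 <= r^-1 * dY y y' by rewrite ler_pdivlMl// mulr1.
lra.
Qed.

(** For a fixed [L], the infimum of [g s y' x + dZ z (i s) + L * dY y y'] over
    [s] and [y'] is the McShane extension of [g] for the metric [dZ + L dY]: it
    is [L]-Lipschitz in [y], but falls short of [g] on [I] when the members of
    [g] are not [L]-Lipschitz. It increases with [L]. The least
    penalty [2 * (dZ z (i s') + c)] decreases with [L] and makes up for the
    shortfall, so that over each [z] only the values of [L] up to some bound depending on
    [z] matter. The second index [s'] is independent of [s]: this is what makes
    both terms monotone in [L]. *)
Definition extension (z : Z) (y : Y) (x : X) : R :=
  cinf [set v | exists L c s s' y', lip_defect s' L c /\
    v = g s y' x + dZ z (i s) + L * dY y y' + 2 * (dZ z (i s') + c)].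

Lemma extension01 z y x : 0 <= extension z y x <= 1.
Proof. by rewrite cinf_ge0 cinf_le1. Qed.

Let dZ0 := pseudo_metric_ge0 dZP.
Let dY0 := pseudo_metric_ge0 dYP.

Let cost_ge0 L c s s' y y' z x : lip_defect s' L c ->
  0 <= g s y' x + dZ z (i s) + L * dY y y' + 2 * (dZ z (i s') + c).
Proof.
move=> [L0 c0 _]; have /andP[h _] := g01 s y' x.
have := dZ0 z (i s); have := dZ0 z (i s').
have := mulr_ge0 L0 (dY0 y y'); lra.
Qed.

Let extension_lip_le z z' y x :
  extension z' y x <= extension z y x + 3 * dZ z z'.
Proof.
apply: cinf_shift => [|v _ [L [c [s [s' [y' [D ->]]]]]]].
  by rewrite mulr_ge0.
exists (g s y' x + dZ z' (i s) + L * dY y y' + 2 * (dZ z' (i s') + c)).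
  exact: cost_ge0.
split; first by exists L, c, s, s', y'.
case: dZP => _ dC dT.
have := dT z' z (i s); have := dT z' z (i s'); rewrite (dC z' z); lra.
Qed.

(** The dependence on [z] is through [dZ z (i s) + 2 * dZ z (i s')] only. *)
Lemma extension_lip z z' y :
  uclose (3 * dZ z z') (extension z y) (extension z' y).
Proof.
apply/ucloseP => x; split; last exact: extension_lip_le.
by case: dZP => _ -> _; exact: extension_lip_le.
Qed.

(** The penalty with [s' = s = s0] and [c] small gives the upper bound. For the
    lower bound, moving from [s] to [s'], then from [y'] to [y] at the cost of
    the defect of [s'], and from [s'] to [s0] costs at most
    [dZ z (i s) + 2 * dZ z (i s') + L * dY y y' + c] at [z = i s0]. *)
Lemma extension_extends s0 y : extension (i s0) y = g s0 y.
Proof.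
case: (dZP) => dd dC dT; case: (dYP) => ddY dCY dTY.
apply/funext => x; apply/eqP; rewrite eq_le; apply/andP; split.
  apply/ler_addgt0Pr => e e0; have e2 : 0 < e / 2 by rewrite divr_gt0.
  have [L DL] := lip_defect_ex s0 e2.
  apply: cinf_le.
    by apply: addr_ge0; [case/andP: (g01 s0 y x)|exact: ltW].
  exists L, (e / 2), s0, s0, y; split=> //; rewrite dd ddY; lra.
apply: cinf_ge => [|v _ [L [c [s [s' [y' [[L0 c0 D] ->]]]]]]].
  by case/andP: (g01 s0 y x).
have /ucloseP/(_ x)[h1 _] := g_lip s0 s' y.
have /ucloseP/(_ x)[h2 _] := g_lip s' s y'.
have := D y y' x; have := dT (i s') (i s0) (i s); rewrite (dC (i s') (i s0)).
lra.
Qed.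

(** Fix [(L0, c0, s0)] with a penalty within [2 * e / 3] of the least one. A
    competitor with [L <= L0] is kept when [y] moves, at a cost [L0 * dY y y'];
    one with [L > L0] is replaced by the one with [L0] and [s0], which has no
    larger Lipschitz term and nearly no larger penalty. *)
Lemma extension_unif z e : 0 < e ->
  exists2 r, 0 < r & forall y y', dY y y' < r ->
    uclose e (extension z y) (extension z y').
Proof.
move=> e0; case: (dYP) => ddY dCY dTY.
(* Half of the least possible penalty, capped at 1. *)
pose C := cinf [set v | exists L c s, lip_defect s L c /\ v = dZ z (i s) + c].
have C_le L c s : lip_defect s L c -> C <= dZ z (i s) + c.
  move=> D; have [_ c0 _] := D.
  by apply: cinf_le; [rewrite addr_ge0|exists L, c, s].
have [C1|C1] := leP 1 C.
  exists 1 => // y y' _; suff E1 w x : extension z w x = 1.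
    by move=> x; rewrite !E1 subrr normr0 ltW.
  apply/eqP; rewrite eq_le cinf_le1; apply: cinf_ge => //.
  move=> v _ [L [c [s [s' [y'' [D ->]]]]]].
  have := C_le _ _ _ D; have [L0 c0 _] := D.
  have := mulr_ge0 L0 (dY0 w y''); have := dZ0 z (i s).
  have /andP[h _] := g01 s y'' x; lra.
have [||v v0 [[L0 [c0 [s0 [D0 ->]]]] vC]] :=
    @cinf_lt _ [set v | exists L c s, lip_defect s L c /\ v = dZ z (i s) + c]
      (Num.min 1 (C + e / 3)).
- by rewrite ge_min lexx.
- by rewrite lt_min C1 ltrDl divr_gt0.
have {}vC : dZ z (i s0) + c0 < C + e / 3 by move: vC; rewrite lt_min => /andP[].
have L00 : 0 <= L0 by case: D0.
have L10 : 0 < L0 + 1 by lra.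
(* [L0] may vanish, hence the [+ 1]. *)
exists (e / 3 / (L0 + 1)); first by rewrite !divr_gt0.
suff H y y' x : dY y y' < e / 3 / (L0 + 1) ->
    extension z y' x <= extension z y x + e.
  by move=> y y' yy'; apply/ucloseP => x; split; apply: H => //; rewrite dCY.
rewrite ltr_pdivlMr// => yy'.
have {}yy' : L0 * dY y y' <= e / 3.
  by have := dY0 y y'; rewrite mulrC; nra.
apply: cinf_shift => [|w _ [L [c [s [s' [y'' [D ->]]]]]]]; first exact: ltW.
have [LL0|LL0] := leP L L0.
  exists (g s y'' x + dZ z (i s) + L * dY y' y'' + 2 * (dZ z (i s') + c)).
    exact: cost_ge0.
  split; first by exists L, c, s, s', y''.
  have [L_ge0 _ _] := D.
  have := ler_wpM2l L_ge0 (dTY y' y y'').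
  have := ler_wpM2r (dY0 y y') LL0.
  rewrite (dCY y' y); lra.
exists (g s y'' x + dZ z (i s) + L0 * dY y' y'' + 2 * (dZ z (i s0) + c0)).
  exact: cost_ge0.
split; first by exists L0, c0, s, s0, y''.
have := C_le _ _ _ D.
have := ler_wpM2l L00 (dTY y' y y'').
have := ler_wpM2r (dY0 y y'') (ltW LL0).
rewrite (dCY y' y); lra.
Qed.

End Extension.

(** * Metrics of a uniform space *)

Section Metrizability.
Context {R : realType}.

Lemma metrizes_equiv (T : uniformType) (d0 d : T -> T -> R) :
  metrizes d0 -> pseudo_metric d ->
  (forall e, 0 < e ->
    exists2 r, 0 < r & forall x y, d0 x y < r -> d x y < e) ->
  (forall e, 0 < e ->
    exists2 r, 0 < r & forall x y, d x y < r -> d0 x y < e) ->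
  metrizes d.
Proof.
move=> d0M dP h1 h2; have d0P := metrizes_pseudo_metric d0M.
case: d0M => _ sep _ _ entE; case: (dP) => dd dC dT.
split=> // [x y dxy|].
  apply: sep; apply/eqP; rewrite eq_le (pseudo_metric_ge0 d0P) andbT.
  apply/ler_addgt0Pl => e /h2[r r0 rP]; rewrite addr0 ltW// rP// dxy//.
rewrite entE; apply/seteqP; split=> V [e e0 eV].
  have [r r0 rP] := h2 _ e0; exists r => // -[x y] /= /rP xy.
  exact: (eV (x, y)).
have [r r0 rP] := h1 _ e0; exists r => // -[x y] /= /rP xy.
exact: (eV (x, y)).
Qed.

Lemma metrizes_min1 (T : uniformType) (d : T -> T -> R) :
  metrizes d -> metrizes (fun x y => Num.min 1 (d x y)).
Proof.
move=> dM; have dP := metrizes_pseudo_metric dM.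
have ge0 := pseudo_metric_ge0 dP; case: (dP) => dd dC dT.
apply: (metrizes_equiv dM).
- split=> [x|x y|x y z]; first by rewrite dd; apply/min_idPr.
    by rewrite dC.
  have := dT x y z; have := ge0 x y; have := ge0 y z.
  by case: (leP 1 (d x z)); case: (leP 1 (d x y)); case: (leP 1 (d y z)); lra.
- by move=> e e0; exists e => // x y xy; rewrite gt_min xy orbT.
move=> e e0; exists (Num.min 1 e); first by rewrite lt_min ltr01.
move=> x y; rewrite lt_min => /andP[].
by rewrite !gt_min ltxx /= => h /orP[h'|//]; exact: lt_trans h h'.
Qed.

Lemma metrizes_scale (T : uniformType) (d : T -> T -> R) k : 0 < k ->
  metrizes d -> metrizes (fun x y => k * d x y).
Proof.
move=> k0 dM; have dP := metrizes_pseudo_metric dM.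
case: (dP) => dd dC dT; apply: (metrizes_equiv dM).
- split=> [x|x y|x y z]; first by rewrite dd mulr0.
    by rewrite dC.
  by rewrite -mulrDr ler_pM2l.
- move=> e e0; exists (e / k); first exact: divr_gt0.
  by move=> x y; rewrite ltr_pdivlMr// mulrC.
- by move=> e e0; exists (k * e); [exact: mulr_gt0|move=> x y; rewrite ltr_pM2l].
Qed.

Lemma unif_continuous_metricP (U V : uniformType) (dU : U -> U -> R)
    (dV : V -> V -> R) (f : U -> V) : metrizes dU -> metrizes dV ->
  unif_continuous f <-> forall e, 0 < e ->
    exists2 r, 0 < r & forall x y, dU x y < r -> dV (f x) (f y) < e.
Proof.
move=> [_ _ _ _ EU] [_ _ _ _ EV]; rewrite /unif_continuous EU EV.
rewrite /cvg_to; split=> [h e e0|h A [e e0 eA]].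
  have [|r r0 rP] := h [set xy | dV xy.1 xy.2 < e]; first by exists e.
  by exists r => // x y; exact: (rP (x, y)).
have [r r0 rP] := h e e0; exists r => // -[x y] /= /rP xy.
exact: (eA (f x, f y)).
Qed.

Lemma metrizes_set_type (T : uniformType) (A : set T) (d : T -> T -> R) :
  metrizes d -> metrizes (fun a b : set_type A => d (set_val a) (set_val b)).
Proof.
case=> dd sep dC dT entE; split=> // [a b /sep|]; first exact: val_inj.
apply/seteqP; split=> V.
  case=> W; rewrite entE => -[e e0 eW] WV.
  by exists e => // -[a b] /= ab; apply: WV; apply: eW.
case=> e e0 eV; exists [set xy | d xy.1 xy.2 < e].
  by rewrite entE; exists e.
by move=> -[a b] /= ab; apply: eV.
Qed.

Lemma closed_metric (T : uniformType) (d : T -> T -> R) (S : set T) z :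
  metrizes d -> closed S -> (forall e, 0 < e -> exists2 s, S s & d z s < e) ->
  S z.
Proof.
move=> [_ _ _ _ entE] clS h; apply: clS => U /nbhsP[V].
rewrite entE => -[e e0 eV] VU.
have [s Ss zs] := h e e0; exists s; split=> //; apply: VU.
by apply/xsectionP; exact: eV.
Qed.

(** A bounded function [D] of two points that is small whenever the images in
    [Z] are close can be dominated by a metric of [Z]. If [D <= c] on the pairs
    at distance less than [r], then [D <= c + d0 / r] everywhere because
    [D <= 1]; the infimum of these affine functions of [d0] is a concave modulus
    of continuity, so composing it with [d0] gives a pseudometric, which is
    added to [d0]. *)
Lemma remetrize (P : Type) (D : P -> P -> R) (Z : uniformType)
    (d0 : Z -> Z -> R) (i : P -> Z) :
  metrizes d0 -> (forall p p', D p p' <= 1) ->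
  (forall e, 0 < e ->
    exists2 r, 0 < r & forall p p', d0 (i p) (i p') < r -> D p p' <= e) ->
  exists2 d, metrizes d & forall p p', D p p' <= d (i p) (i p').
Proof.
move=> d0M D1 h; have d0P := metrizes_pseudo_metric d0M.
have ge0 := pseudo_metric_ge0 d0P; case: (d0P) => dd dC dT.
pose S z z' := [set v | exists r c, [/\ 0 < r, 0 <= c,
  forall p p', d0 (i p) (i p') < r -> D p p' <= c & v = c + d0 z z' / r]].
pose d1 z z' := cinf (S z z').
have d1_le r c z z' : 0 < r -> 0 <= c ->
    (forall p p', d0 (i p) (i p') < r -> D p p' <= c) ->
    d1 z z' <= c + d0 z z' / r.
  move=> r0 c0 rc; apply: cinf_le; last by exists r, c.
  by rewrite addr_ge0// divr_ge0// ltW.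
have d1_ge0 z z' : 0 <= d1 z z' by exact: cinf_ge0.
exists (fun z z' => d0 z z' + d1 z z'); last first.
  move=> p p'; have : D p p' <= d1 (i p) (i p').
    apply: cinf_ge => // v _ [r [c [r0 c0 rc ->]]].
    have [/rc pp'|pp'] := ltP (d0 (i p) (i p')) r.
      have : 0 <= d0 (i p) (i p') / r by rewrite divr_ge0// ltW.
      lra.
    have : 1 <= d0 (i p) (i p') / r by rewrite ler_pdivlMr// mul1r.
    have := D1 p p'; lra.
  have := ge0 (i p) (i p'); lra.
apply: (metrizes_equiv d0M).
- split=> [z|z z'|z z' z''].
  + rewrite dd add0r; apply/eqP; rewrite eq_le d1_ge0 andbT.
    apply/ler_addgt0Pl => e e0; have [r r0 rP] := h _ e0.
    by have := d1_le _ _ z z r0 (ltW e0) rP; rewrite dd mul0r.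
  + by rewrite /d1 /S dC.
  + have : d1 z z'' <= d1 z z' + d1 z' z''.
      apply: cinf_add => v w v0 [r1 [c1 [r10 c10 rc1 vE]]]
        w0 [r2 [c2 [r20 c20 rc2 wE]]].
      have key r c : 0 < r -> 0 <= c ->
          (forall p p', d0 (i p) (i p') < r -> D p p' <= c) ->
          c + (d0 z z' + d0 z' z'') / r <= v + w ->
          exists2 u, 0 <= u & S z z'' u /\ u <= v + w.
        move=> r0 c0 rc cvw; exists (c + d0 z z'' / r).
          by rewrite addr_ge0// divr_ge0// ltW.
        split; first by exists r, c.
        apply: le_trans cvw; rewrite lerD2l ler_pM2r ?invr_gt0//.
      (* The larger of the two radii serves for both terms. *)
      have [r12|r21] := leP r1 r2.
        apply: (key r2 c2) => //; rewrite vE wE mulrDl.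
        have : d0 z z' / r2 <= d0 z z' / r1.
          by rewrite ler_wpM2l// lef_pV2.
        lra.
      apply: (key r1 c1) => //; rewrite vE wE mulrDl.
      have : d0 z' z'' / r1 <= d0 z' z'' / r2.
        by rewrite ler_wpM2l// lef_pV2// ltW.
      lra.
    have := dT z z' z''; lra.
- move=> e e0; have e4 : 0 < e / 4 by rewrite divr_gt0.
  have [r r0 rP] := h _ e4; exists (Num.min (e / 4) (e / 4 * r)).
    by rewrite lt_min e4 mulr_gt0.
  move=> z z'; rewrite lt_min => /andP[h1]; rewrite -ltr_pdivrMr// => h2.
  have := d1_le _ _ z z' r0 (ltW e4) rP; lra.
- by move=> e e0; exists e => // z z'; have := d1_ge0 z z'; lra.
Qed.

End Metrizability.

(** * The uniform space of a metric *)

Section MetricSpace.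
Context {R : realType} {T : Type} {d : T -> T -> R}.

(** A copy of [T] that records the proof about [d], so that the uniform
    structure of [d] can be attached to it. *)
Definition metric_space of pseudo_metric d := T.

Hypothesis dP : pseudo_metric d.
Local Open Scope relation_scope.

HB.instance Definition _ := gen_eqMixin (metric_space dP).
HB.instance Definition _ := gen_choiceMixin (metric_space dP).

Let ent := entourage_
  (fun (x : metric_space dP) (e : R) => [set y : metric_space dP | d x y < e]).

Let ent_filter : Filter ent.
Proof.
apply: filter_from_filter; first by exists 1 => /=.
move=> e e' e0 e'0; exists (Num.min e e'); first by rewrite /= lt_min e0.
by move=> xy /=; rewrite lt_min => /andP.
Qed.

Let ent_refl A : ent A -> diagonal `<=` A.
Proof.
have [dd _ _] := dP => -[e e0 eA] [x y] /= xy; apply: eA => /=.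
by rewrite (xy : x = y) dd.
Qed.

Let ent_inv A : ent A -> ent A^-1.
Proof.
have [_ dC _] := dP => -[e e0 eA].
by exists e => // xy /= xye; apply: eA; rewrite /= dC.
Qed.

Let ent_split A : ent A -> exists2 B, ent B & B \; B `<=` A.
Proof.
have [_ _ dT] := dP => -[e e0 eA].
exists [set xy | d xy.1 xy.2 < e / 2].
  by exists (e / 2) => //=; rewrite divr_gt0.
move=> [x y] [z /= xz zy]; apply: eA => /=; have := dT x z y; lra.
Qed.

HB.instance Definition _ := @isUniform.Build (metric_space dP)
  ent ent_filter ent_refl ent_inv ent_split.

Lemma metric_space_metrizes : (forall x y, d x y = 0 -> x = y) ->
  metrizes (d : metric_space dP -> metric_space dP -> R).
Proof. by move=> sep; have [] := dP. Qed.

End MetricSpace.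

(** * Retractions of collars in function spaces *)

Section Collar.
Context {R : realType} {X : Type}.
Implicit Types (J : set (X -> R)) (t k : R).

Definition unit_valued (e : X -> R) := forall x, 0 <= e x <= 1.

(** The bounded functions carry a height coordinate, and at height 0 only [J]
    remains. In this space [J], placed at height 0, is closed even if [J] is not
    closed among the functions; this is how a uniform A(N)R that is not complete
    can be confronted with the extension property. *)
Definition punctured J : set ((X -> R) * R) :=
  [set w | [/\ unit_valued w.1, 0 <= w.2 & w.2 = 0 -> J w.1]].

(** If [J] is a nonempty set of functions with values in the unit interval, then
    [k = 2] only bounds the height; so the absolute case is the case of a wide
    collar, and the neighbourhood case that of a thin one. *)
Definition collar J k : set ((X -> R) * R) :=
  [set w | [/\ punctured J w, w.2 < k & exists2 p, J p & uclose k w.1 p]].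

(** Maps are total with values among the functions, and only their behaviour on
    [D] matters; membership of the values in [J] is stated separately. *)
Definition unif_on (D : set ((X -> R) * R)) (r : (X -> R) * R -> X -> R) :=
  forall eps, 0 < eps -> exists2 rho, 0 < rho &
    forall w w', D w -> D w' -> uclose rho w.1 w'.1 -> `|w.2 - w'.2| <= rho ->
      uclose eps (r w) (r w').

Definition collar_retraction J k (r : (X -> R) * R -> X -> R) :=
  [/\ forall w, collar J k w -> J (r w), forall e, J e -> r (e, 0) = e
    & unif_on (collar J k) r].

Definition sup_dist (e e' : X -> R) : R := cinf [set v | uclose v e e'].

Lemma uclose_sym k (e e' : X -> R) : uclose k e e' -> uclose k e' e.
Proof. by move=> h x; rewrite distrC. Qed.

Lemma uclose_trans (e2 : X -> R) k1 k2 e1 e3 :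
  uclose k1 e1 e2 -> uclose k2 e2 e3 -> uclose (k1 + k2) e1 e3.
Proof. by move=> h1 h2 x; apply: le_trans (ler_distD (e2 x) _ _) (lerD _ _). Qed.

Lemma uclose_refl k (e : X -> R) : 0 <= k -> uclose k e e.
Proof. by move=> k0 x; rewrite subrr normr0. Qed.

Lemma uclose_le k k' (e e' : X -> R) : k <= k' -> uclose k e e' -> uclose k' e e'.
Proof. by move=> kk' h x; exact: le_trans (h x) kk'. Qed.

Lemma uclose_unit_valued e e' : unit_valued e -> unit_valued e' -> uclose 1 e e'.
Proof.
by move=> h h'; apply/ucloseP => x; have /andP[] := h x; have /andP[] := h' x; lra.
Qed.

Lemma uclose_sup_dist e e' : unit_valued e -> unit_valued e' ->
  uclose (sup_dist e e') e e'.
Proof.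
move=> h h' x; apply: cinf_ge => [|v _ ev]; last exact: ev.
exact: uclose_unit_valued.
Qed.

Lemma sup_dist_le k e e' : 0 <= k -> uclose k e e' -> sup_dist e e' <= k.
Proof. exact: cinf_le. Qed.

Definition punctured_dist (w w' : (X -> R) * R) : R :=
  sup_dist w.1 w'.1 + `|w.2 - w'.2|.

Lemma punctured_dist_pseudo_metric : pseudo_metric punctured_dist.
Proof.
split=> [w|w w'|w1 w2 w3]; rewrite /punctured_dist.
- rewrite subrr normr0 addr0; apply/eqP; rewrite eq_le cinf_ge0 andbT.
  by apply: sup_dist_le => //; exact: uclose_refl.
- rewrite distrC; congr (cinf _ + _).
  by apply/seteqP; split=> v; exact: uclose_sym.
- have := ler_distD w2.2 w1.2 w3.2.
  suff : sup_dist w1.1 w3.1 <= sup_dist w1.1 w2.1 + sup_dist w2.1 w3.1 by lra.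
  apply: cinf_add => v v' v0 wv v'0 wv'; exists (v + v'); first exact: addr_ge0.
  by split=> //; exact: uclose_trans wv wv'.
Qed.

Lemma restrict_pseudo_metric T S (d : T -> T -> R) (f : S -> T) :
  pseudo_metric d -> pseudo_metric (fun x y => d (f x) (f y)).
Proof. by move=> [? ? ?]; split. Qed.

(** Throughout, [j] is an isometry of [P] onto a set of functions with values in
    the unit interval. *)
Section Embedding.
Context {P : uniformType} (dP : P -> P -> R) (j : P -> X -> R).
Hypothesis dPM : metrizes dP.
Hypothesis j01 : forall p, unit_valued (j p).
Hypothesis j_uclose : forall p p', uclose (dP p p') (j p) (j p').
Hypothesis uclose_j :
  forall p p' k, uclose k (j p) (j p') -> dP p p' <= k.

Let dPP := metrizes_pseudo_metric dPM.

(* The punctured space of [range j] as a metrizable uniform space, with [P] at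
   height 0 as a closed subspace. *)
Let W : uniformType := metric_space (restrict_pseudo_metric
  (fun w : punctured (range j) => set_val w) punctured_dist_pseudo_metric).
Let dW (w w' : W) : R := punctured_dist (set_val (w : punctured (range j)))
  (set_val (w' : punctured (range j))).

Let valW (w : W) : (X -> R) * R := set_val (w : punctured (range j)).

Let valW_P w : punctured (range j) (valW w).
Proof. exact: set_valP. Qed.

Let valW_inj : injective valW.
Proof. exact: val_inj. Qed.

Let dWM : metrizes dW.
Proof.
apply: metric_space_metrizes => w w' ww'; apply: valW_inj.
have [h1 _ _] := valW_P w; have [h2 _ _] := valW_P w'.
have E : sup_dist (valW w).1 (valW w').1 + `|(valW w).2 - (valW w').2| = 0.
  exact: ww'.
have s0 := cinf_ge0 [set v | uclose v (valW w).1 (valW w').1].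
rewrite -/(sup_dist _ _) in s0.
have n0 := normr_ge0 ((valW w).2 - (valW w').2).
have E1 : sup_dist (valW w).1 (valW w').1 = 0 by lra.
have E2 : `|(valW w).2 - (valW w').2| = 0 by lra.
rewrite [valW w]surjective_pairing [RHS]surjective_pairing; congr pair.
  apply/funext => x; apply/eqP; rewrite -subr_eq0 -normr_le0 -E1.
  exact: uclose_sup_dist.
by apply/eqP; rewrite -subr_eq0 -normr_eq0 E2.
Qed.

Let base_subproof p : punctured (range j) (j p, 0).
Proof. by split=> [||_]; [exact: j01|exact: lexx|exists p]. Qed.

Let base (p : P) : W := SigSub (mem_set (base_subproof p)).

Let valW_base p : valW (base p) = (j p, 0).
Proof. by []. Qed.

Let dW_base p p' : dW (base p) (base p') = dP p p'.
Proof.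
rewrite /dW /punctured_dist /= subrr normr0 addr0; apply/eqP.
have ge0 := pseudo_metric_ge0 dPP p p'.
by rewrite eq_le sup_dist_le//=; apply: uclose_j; exact: uclose_sup_dist.
Qed.

Let base_embedding : uniform_embedding base.
Proof.
have inj : injective base.
  move=> p p' pp'; have [_ sep _ _ _] := dPM; apply: sep.
  by rewrite -dW_base pp'; have [dd _ _ _ _] := dWM.
split=> //.
  apply/(unif_continuous_metricP _ dPM dWM) => e e0.
  by exists e => // p p'; rewrite dW_base.
have ex (z : range base) : exists p, base p = set_val z.
  by have [p _ pz] := set_valP z; exists p.
pose g z := sval (cid (ex z)); exists g.
have gE z : base (g z) = set_val z by exact: svalP (cid (ex z)).
split=> //; apply/(unif_continuous_metricP _ (metrizes_set_type _ dWM) dPM).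
by move=> e e0; exists e => // z z'; rewrite -!gE dW_base.
Qed.

Let base_closed : closed (range base).
Proof.
move=> w clw; have [w01 w0 wJ] := valW_P w.
have h e : 0 < e -> exists2 p, True & dW w (base p) < e.
  move=> e0.
  have [|_ [[p _ <-] /= wp]] := clw [set w' | dW w w' < e]; last by exists p.
  have [_ _ _ _ entE] := dWM.
  apply/nbhsP; exists [set xy | dW xy.1 xy.2 < e].
    by rewrite entE; exists e.
  by move=> w' /xsectionP.
(* A limit of points of height 0 has height 0, hence lies over [range j]. *)
have w2 : (valW w).2 = 0.
  apply/eqP; rewrite eq_le w0 andbT; apply/ler_addgt0Pl => e /h[p _].
  rewrite addr0 /dW /punctured_dist /= subr0 ger0_norm//.
  have := cinf_ge0 [set v | uclose v (valW w).1 (j p)].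
  rewrite /sup_dist /valW; lra.
have [p _ pw] := wJ w2; exists p => //; apply: valW_inj.
by rewrite valW_base [RHS]surjective_pairing pw w2.
Qed.

(** A retraction of [W] onto [P], read off in coordinates and extended by the
    zero function outside its domain. *)
Lemma collar_retraction_of_retraction k (N : set W)
    (r : set_type N -> range base) :
  (forall w, collar (range j) k (valW w) -> N w) ->
  unif_continuous r ->
  (forall (x : N) (s : range base), set_val x = set_val s -> r x = s) ->
  0 < k -> exists r', collar_retraction (range j) k r'.
Proof.
move=> kN ru rE k0.
pose lift w := [set x : N | valW (set_val x) = w].
pose r' w : X -> R :=
  if pselect (exists x, lift w x) is left h
  then (valW (set_val (r (sval (cid h))))).1 else fun=> 0.
have r'E (x : N) w : valW (set_val x) = w ->
    r' w = (valW (set_val (r x))).1.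
  move=> xw; rewrite /r'; case: pselect => [h|[]]; last by exists x.
  have : lift w (sval (cid h)) by exact: svalP (cid h).
  by move=> E; congr (valW (set_val (r _))).1; apply/val_inj/valW_inj; rewrite E.
have liftP w : collar (range j) k w -> exists x, lift w x.
  move=> cw; have [pw _ _] := cw.
  have Nw : N (SigSub (mem_set pw) : W) by exact: kN.
  by exists (SigSub (mem_set Nw)).
exists r'; split.
- move=> w /liftP[x xw]; rewrite (r'E _ _ xw).
  have [p _ pE] := set_valP (r x); exists p => //.
  have E := congr1 (fun w : W => (valW w).1) pE.
  exact: E.
- move=> _ [p _ <-].
  have /liftP[x xw] : collar (range j) k (j p, 0).
    split=> //; exists (j p); first by exists p.
    exact/uclose_refl/ltW.
  have bp : range base (base p) by exists p.
  rewrite (r'E _ _ xw) (rE x (SigSub (mem_set bp)))//.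
  exact: valW_inj.
- move=> e e0.
  have /(unif_continuous_metricP _ (metrizes_set_type _ dWM)
    (metrizes_set_type _ dWM))/(_ _ e0)[rho rho0 h] := ru.
  exists (rho / 3) => [|w w' /liftP[x xw] /liftP[x' xw'] ww1 ww2].
    by rewrite divr_gt0.
  rewrite (r'E _ _ xw) (r'E _ _ xw').
  have : dW (set_val (r x)) (set_val (r x')) < e.
    apply: h; rewrite /dW /punctured_dist.
    rewrite -/(valW (set_val x)) -/(valW (set_val x')) xw xw'.
    have : sup_dist w.1 w'.1 <= rho / 3.
      by apply: sup_dist_le => //; rewrite ltW// divr_gt0.
    lra.
  rewrite /dW /punctured_dist => he.
  have := normr_ge0 ((valW (set_val (r x))).2 - (valW (set_val (r x'))).2).
  rewrite /valW => n0.
  apply: (@uclose_le (sup_dist (valW (set_val (r x))).1 (valW (set_val (r x'))).1)).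
    by rewrite /valW; lra.
  by apply: uclose_sup_dist; [have [] := valW_P (set_val (r x))|
    have [] := valW_P (set_val (r x'))].
Qed.

Lemma uniform_AR_collar k : uniform_AR R P -> 0 < k ->
  exists r, collar_retraction (range j) k r.
Proof.
move=> [_ AR] k0.
have [|r [ru rE]] := AR W base _ base_embedding base_closed.
  by exists dW.
have WM := metrizes_set_type _ dWM.
apply: (@collar_retraction_of_retraction k setT
  (fun x : set_type setT => r (set_val x))) => //.
- apply/(unif_continuous_metricP _ (WM _) (WM _)) => e e0.
  have /(unif_continuous_metricP _ dWM (WM _))/(_ _ e0)[rho rho0 h] := ru.
  by exists rho => // x y; exact: h.
- by move=> x s ->; rewrite rE.
Qed.

Lemma uniform_ANR_collar : uniform_ANR R P ->
  exists2 k, 0 < k & exists r, collar_retraction (range j) k r.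
Proof.
move=> [_ ANR].
have [|N [[d dM [e e0 eN]] [r [ru rE]]]] := ANR W base _ base_embedding base_closed.
  by exists dW.
have [rho rho0 h] : exists2 rho, 0 < rho &
    forall x y, dW x y < rho -> d x y < e.
  have : unif_continuous (fun w : W => w).
    by move=> V EV; apply: filterS EV => -[].
  by move=> /(unif_continuous_metricP _ dWM dM) h; have [rho] := h _ e0; exists rho.
exists (rho / 3); first by rewrite divr_gt0.
apply: (collar_retraction_of_retraction _ ru rE); last by rewrite divr_gt0.
move=> w [[_ w0 _] w2 [_ [p _ <-] wp]]; apply: (eN (base p)).
  by exists p.
have [_ _ dC _ _] := dM; rewrite dC; apply: h.
rewrite /dW /punctured_dist /= subr0 ger0_norm//.
have : sup_dist (valW w).1 (j p) <= rho / 3.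
  by apply: sup_dist_le => //; rewrite ltW// divr_gt0.
move: w2; rewrite /valW; lra.
Qed.

End Embedding.
End Collar.

(** * Retractions that respect a pair *)

Section PairRetraction.
Context {R : realType} {X : Type}.
Variables JX JA : set (X -> R).

Definition dist_to (J : set (X -> R)) (e : X -> R) : R :=
  cinf [set v | exists2 a, J a & uclose v e a].

Lemma dist_to_le J k (e e' : X -> R) : 0 <= k -> uclose k e e' ->
  dist_to J e' <= dist_to J e + k.
Proof.
move=> k0 ee'; apply: cinf_shift => // v v0 [a Ja ea].
exists (v + k); first exact: addr_ge0.
split=> //; exists a => //; rewrite addrC.
exact: uclose_trans (uclose_sym ee') ea.
Qed.

(** The condition on [JA] concerns the cone of the points whose distance to [JA]
    is at most their height. In the application the height bounds from above the
    distance to [JA] at the points of [B], and the cone replaces a condition on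
    [B] itself. *)
Definition pair_retraction k (r : (X -> R) * R -> X -> R) :=
  [/\ forall w, collar JX k w -> JX (r w), forall e, JX e -> r (e, 0) = e,
      forall w, collar JX k w -> 0 < w.2 -> dist_to JA w.1 <= w.2 -> JA (r w)
    & unif_on (collar JX k) r].

Hypothesis JAX : JA `<=` JX.
Hypothesis JX01 : forall e, JX e -> unit_valued e.

(** The retraction for the pair is [rX] after a map of the punctured space that
    pushes the cone over [JA] down to height 0 along [rA] and fixes [JX]. Away
    from the cone, [rA] is blended into the identity. *)
Section Blend.
Variables (kA kX : R) (rA rX : (X -> R) * R -> X -> R).
Hypotheses (kA0 : 0 < kA) (kX0 : 0 < kX).
Hypotheses (rAP : collar_retraction JA kA rA).
Hypotheses (rXP : collar_retraction JX kX rX).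

(** Equal to 1 on the cone, and to 0 where the distance to [JA] is at least
    twice the height. At height 0 the division returns 0, so the weight is 0
    there. *)
Definition weight (w : (X -> R) * R) : R :=
  Num.max 0 (Num.min 1 ((2 * w.2 - dist_to JA w.1) / w.2)).

Definition blend (w : (X -> R) * R) : X -> R :=
  fun x => w.1 x + weight w * (rA w x - w.1 x).

(** Among heights at least 0, it vanishes exactly at height 0 and on the cone:
    the places where [blend] is known to lie in [JX]. *)
Definition blend_height (w : (X -> R) * R) : R :=
  Num.max 0 (Num.min w.2 (dist_to JA w.1 - w.2)).

(* Where the weight does not vanish, [rA] must be in its domain. *)
Variable k : R.
Hypothesis collarA : forall w, collar JX k w -> 0 < w.2 ->
  dist_to JA w.1 < 2 * w.2 -> collar JA kA w.

Let weight01 w : 0 <= weight w <= 1.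
Proof. by rewrite /weight le_max lexx ge_max ler01 ge_min lexx. Qed.

Let weight_gt0 w : collar JX k w -> weight w != 0 ->
  0 < w.2 /\ dist_to JA w.1 < 2 * w.2.
Proof.
move=> cw l_neq0; have [[_ t0 _] _ _] := cw.
have : 0 < weight w by have /andP[h _] := weight01 w; rewrite lt_def l_neq0.
rewrite /weight lt_max ltxx /= lt_min ltr01 /= => q.
have {}t0 : 0 < w.2.
  by rewrite lt_def t0 andbT; apply/eqP => t; move: q; rewrite t invr0 mulr0 ltxx.
by split=> //; move: q; rewrite pmulr_lgt0 ?invr_gt0// subr_gt0.
Qed.

Let weight_cases w : collar JX k w -> weight w = 0 \/ collar JA kA w.
Proof.
move=> cw; have [->|/(weight_gt0 cw)[t0 Dt]] := eqVneq (weight w) 0; first by left.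
by right; exact: collarA.
Qed.

Let rA01 w : collar JA kA w -> unit_valued (rA w).
Proof. by case: rAP => h _ _ /h/JAX/JX01. Qed.

Let weight_diff w w' s rho : 0 < s -> 0 <= rho -> s <= w.2 -> s <= w'.2 ->
  uclose rho w.1 w'.1 -> `|w.2 - w'.2| <= rho ->
  weight w <= weight w' + rho * (1 + s^-1) / s.
Proof.
move=> s0 rho0 sw sw' ww1; rewrite ler_norml => /andP[ww2 ww2'].
pose D := dist_to JA w.1; pose D' := dist_to JA w'.1.
have DD : D' <= D + rho by exact: dist_to_le.
have [D0 D1] : 0 <= D /\ D <= 1 by split; [exact: cinf_ge0|exact: cinf_le1].
have w20 : 0 < w.2 by lra.
have w20' : 0 < w'.2 by lra.
have kappa0 : 0 <= rho * (1 + s^-1) / s.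
  have := @invr_ge0 R s; rewrite (ltW s0) => si.
  by rewrite !mulr_ge0// addr_ge0.
have qE u : 0 < u.2 -> (2 * u.2 - dist_to JA u.1) / u.2 =
    2 - dist_to JA u.1 / u.2.
  by move=> u0; rewrite mulrBl -mulrA mulfV ?mulr1// gt_eqF.
suff : D' / w'.2 <= D / w.2 + rho * (1 + s^-1) / s.
  rewrite /weight !qE// -/D -/D'.
  move: (D / w.2) (D' / w'.2) (rho * (1 + s^-1) / s) kappa0 => q q' kappa kappa0 qq'.
  have m0 : 0 <= Num.max 0 (Num.min 1 (2 - q')) by rewrite le_max lexx.
  have m1 : Num.min 1 (2 - q') <= Num.max 0 (Num.min 1 (2 - q')).
    by rewrite le_max lexx orbT.
  rewrite ge_max; apply/andP; split; first by lra.
  rewrite ge_min; apply/orP; move: m1; case: (leP 1 (2 - q')) => ? ?.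
    by left; lra.
  by right; lra.
rewrite ler_pdivrMr// mulrDl.
have q1 : D / w.2 <= s^-1.
  rewrite ler_pdivrMr//; apply: le_trans D1 _.
  by rewrite ler_pdivlMl// mulr1.
have q0 : 0 <= D / w.2 by rewrite divr_ge0// ltW.
have DE : D = D / w.2 * w.2 by rewrite divfK// gt_eqF.
have h1 : rho * (1 + s^-1) <= rho * (1 + s^-1) / s * w'.2.
  have A0 : 0 <= rho * (1 + s^-1).
    by rewrite mulr_ge0// addr_ge0// invr_ge0 ltW.
  move: (rho * _) A0 => A A0; rewrite -mulrA ler_peMr//.
  by rewrite ler_pdivlMl// mulr1.
have h2 : D / w.2 * w.2 <= D / w.2 * w'.2 + rho * s^-1.
  have : D / w.2 * (w.2 - w'.2) <= s^-1 * rho.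
    by have := ler_pM q0; nra.
  lra.
lra.
Qed.

Lemma blend_unit_valued w : collar JX k w -> unit_valued (blend w).
Proof.
move=> cw x; have [[w01 _ _] _ _] := cw; have /andP[h0 h1] := w01 x.
rewrite /blend; have /andP[l0 l1] := weight01 w.
have [->|/rA01/(_ x)/andP[a0 a1]] := weight_cases cw.
  by rewrite mul0r addr0 h0.
by apply/andP; split; nra.
Qed.

(** At a small height [t], a point of positive weight is within [2 * t] of some
    [a] in [JA]; as [rA] fixes [a], it moves the point little. *)
Lemma blend_close eps : 0 < eps -> exists2 t0, 0 < t0 &
  forall w, collar JX k w -> w.2 < t0 -> uclose eps (blend w) w.1.
Proof.
move=> e0; have [_ rA0 rAu] := rAP.
have [|rho rho0 h] := rAu (eps / 2); first by rewrite divr_gt0.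
pose t0 := Num.min (rho / 2) (Num.min (eps / 4) (1 / 2)).
exists t0; first by rewrite !lt_min !divr_gt0.
move=> w cw; rewrite !lt_min => /and3P[t_rho t_eps t_half] x.
rewrite /blend addrAC subrr add0r normrM.
have /andP[l0 l1] := weight01 w.
have [->|cA] := weight_cases cw; first by rewrite normr0 mul0r ltW.
have [->|l_neq0] := eqVneq (weight w) 0; first by rewrite normr0 mul0r ltW.
have [[w01 w0 _] wk _] := cw.
have [_ D2] := weight_gt0 cw l_neq0.
have [|v v0 [[a Ja wa] vt]] := cinf_lt _ D2; first by lra.
have ca : collar JA kA (a, 0).
  split=> //; last by exists a => //; exact/uclose_refl/ltW.
  by split=> //=; exact/JX01/JAX.
have := h w (a, 0) cA ca; rewrite /= subr0 ger0_norm// rA0//.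
have rhow : uclose rho w.1 a by apply: uclose_le wa; lra.
have wrho : w.2 <= rho by lra.
move=> /(_ rhow wrho) /ucloseP/(_ x)[h1 h2].
have /ucloseP/(_ x)[h3 h4] := wa.
rewrite (ger0_norm l0); apply: (@le_trans _ _ (1 * eps)); last by rewrite mul1r.
apply: ler_pM => //; rewrite ler_norml; apply/andP; lra.
Qed.

(** The weight has a Lipschitz constant of the order of the inverse square of
    the height, so two regimes are needed: near height 0 the blend is close to
    the identity by [blend_close], and above a fixed height the weight is
    Lipschitz. *)
Lemma blend_unif : unif_on (collar JX k) blend.
Proof.
move=> eps eps0; have e3 : 0 < eps / 3 by rewrite divr_gt0.
have [t0 t00 near] := blend_close e3.
have [_ _ rAu] := rAP; have [rhoA rhoA0 hA] := rAu _ e3.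
pose s := t0 / 4; have s0 : 0 < s by rewrite divr_gt0.
(* A Lipschitz constant of the weight above the height [s]. *)
pose c := (1 + s^-1) / s.
have c0 : 0 < c by rewrite divr_gt0// addr_gt0// invr_gt0.
have e6 : 0 < eps / 3 / 2 by rewrite divr_gt0.
pose rho := Num.min (Num.min s (eps / 3 / 2)) (Num.min rhoA (eps / 3 / 2 / c)).
have rho0 : 0 < rho by rewrite !lt_min s0 rhoA0 e6 divr_gt0.
have [rho_s [rho_e [rho_A rho_c]]] :
    rho <= s /\ rho <= eps / 3 / 2 /\ rho <= rhoA /\ rho * c <= eps / 3 / 2.
  by rewrite -(ler_pdivlMr _ _ c0) !ge_min !lexx ?orbT.
exists rho => // w w' cw cw' ww1 ww2.
have /andP[dt dt'] : - rho <= w.2 - w'.2 <= rho by rewrite -ler_norml.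
have sE : t0 = 4 * s by rewrite /s; lra.
have [t1|t1] := ltP w.2 (2 * s).
  have n1 : uclose (eps / 3) (blend w) w.1 by apply: near => //; lra.
  have n2 : uclose (eps / 3) (blend w') w'.1 by apply: near => //; lra.
  apply: uclose_le (uclose_trans (uclose_trans n1 ww1) (uclose_sym n2)); lra.
have [[w01 _ _] _ _] := cw; have [[w01' _ _] _ _] := cw'.
have [l01 l01'] := (weight01 w, weight01 w').
have [sw sw'] : s <= w.2 /\ s <= w'.2 by split; lra.
have l1 : weight w <= weight w' + rho * c.
  by rewrite /c mulrA; apply: weight_diff => //; exact: ltW.
have l2 : weight w' <= weight w + rho * c.
  rewrite /c mulrA; apply: weight_diff => //; [exact: ltW|exact: uclose_sym|].
  by rewrite distrC.
move=> x; rewrite /blend.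
have /andP[h1 h2] : - rho <= w.1 x - w'.1 x <= rho by rewrite -ler_norml ww1.
have /andP[e0x e1x] := w01 x; have /andP[e0x' e1x'] := w01' x.
move: l01 l01' l1 l2.
have [->|cA] := weight_cases cw; have [->|cA'] := weight_cases cw'.
- rewrite !mul0r !addr0 => _ _ _ _; rewrite ler_norml; apply/andP; lra.
- have /andP[a0 a1] := rA01 cA' x; move=> _ /andP[l0 l1'] _ l2.
  rewrite ler_norml; apply/andP; nra.
- have /andP[a0 a1] := rA01 cA x; move=> /andP[l0 l1'] _ l1 _.
  rewrite ler_norml; apply/andP; nra.
have /andP[a0 a1] := rA01 cA x; have /andP[a0' a1'] := rA01 cA' x.
have /ucloseP/(_ x)[h3 h4] : uclose (eps / 3) (rA w) (rA w').
  apply: hA => //; first exact: uclose_le ww1.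
  exact: le_trans ww2 _.
move=> /andP[l0 l01] /andP[l0' l01'] l1 l2.
rewrite ler_norml; apply/andP; nra.
Qed.

Let blend_height_diff w w' rho : 0 <= rho -> uclose rho w.1 w'.1 ->
  `|w.2 - w'.2| <= rho -> blend_height w <= blend_height w' + 2 * rho.
Proof.
move=> rho0 ww1; rewrite ler_norml /blend_height => /andP[t1 t2].
have D1 := dist_to_le JA rho0 (uclose_sym ww1).
move: (dist_to JA w.1) (dist_to JA w'.1) D1 => D D' D1.
have m0 : 0 <= Num.max 0 (Num.min w'.2 (D' - w'.2)) by rewrite le_max lexx.
have m1 : Num.min w'.2 (D' - w'.2) <= Num.max 0 (Num.min w'.2 (D' - w'.2)).
  by rewrite le_max lexx orbT.
rewrite ge_max; apply/andP; split; first by lra.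
rewrite ge_min; apply/orP; move: m1; case: (leP w'.2 (D' - w'.2)) => ? ?.
  by left; lra.
by right; lra.
Qed.

Let blend_height0 w : collar JX k w -> blend_height w = 0 ->
  w.2 = 0 \/ 0 < w.2 /\ dist_to JA w.1 <= w.2.
Proof.
move=> [[_ t0 _] _ _] /eqP; rewrite /blend_height eq_le => /andP[+ _].
rewrite ge_max ge_min => /andP[_ /orP[t|Dt]].
  by left; apply/eqP; rewrite eq_le t.
have [->|t_neq0] := eqVneq w.2 0; first by left.
by right; split; [rewrite lt_def t_neq0|rewrite -subr_le0].
Qed.

Let blend_base e : blend (e, 0) = e.
Proof.
apply/funext => x; rewrite /blend /weight /= invr0 mulr0.
have -> : Num.max 0 (Num.min 1 0) = 0 :> R.
  by apply/max_idPl; rewrite ge_min lexx orbT.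
by rewrite mul0r addr0.
Qed.

Let blend_in_JA w : collar JX k w -> 0 < w.2 -> dist_to JA w.1 <= w.2 ->
  JA (blend w).
Proof.
move=> cw t0 Dt; have -> : blend w = rA w.
  apply/funext => x; rewrite /blend /weight.
  have -> : Num.max 0 (Num.min 1 ((2 * w.2 - dist_to JA w.1) / w.2)) = 1.
    have h : 1 <= (2 * w.2 - dist_to JA w.1) / w.2.
      by rewrite ler_pdivlMr// mul1r; lra.
    by rewrite (min_idPl h); apply/max_idPr.
  by rewrite mul1r addrC subrK.
by have [h _ _] := rAP; apply: h; apply: collarA => //; lra.
Qed.

Lemma blend_punctured w : collar JX k w -> punctured JX (blend w, blend_height w).
Proof.
move=> cw; split=> /=; [exact: blend_unit_valued|by rewrite le_max lexx|].
move=> /(blend_height0 cw)[t|[t Dt]]; last exact/JAX/blend_in_JA.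
have [[_ _ h] _ _] := cw.
by rewrite [w]surjective_pairing t blend_base; exact: h.
Qed.

(** At height 0 the blend is the identity and on the cone it takes values in
    [JA], so [(blend w, blend_height w)] is a point of the punctured space of
    [JX], and it lies in [JX] at height 0 when [w] is in the cone. The
    assumption keeps it within the domain of [rX]. *)
Lemma pair_retraction_blend k' : k' <= k ->
  (forall w, collar JX k' w ->
    blend_height w < kX /\ exists2 p, JX p & uclose kX (blend w) p) ->
  pair_retraction k' (fun w => rX (blend w, blend_height w)).
Proof.
move=> k'k inX; have [rX1 rX0 rXu] := rXP.
have sub w : collar JX k' w -> collar JX k w.
  move=> [pw w2 [p Jp wp]]; split=> //; first exact: lt_le_trans w2 k'k.
  by exists p => //; exact: uclose_le wp.
have cX w : collar JX k' w -> collar JX kX (blend w, blend_height w).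
  by move=> cw; have [h1 h2] := inX w cw; split=> //; exact/blend_punctured/sub.
split=> [w /cX/rX1//|e Je|w /sub cw t0 Dt|eps eps0].
- rewrite blend_base /blend_height /= subr0.
  have -> : Num.max 0 (Num.min 0 (dist_to JA e)) = 0 :> R.
    by apply/max_idPl; rewrite ge_min lexx.
  exact: rX0.
- have -> : blend_height w = 0.
    by apply/max_idPl; rewrite ge_min subr_le0 Dt orbT.
  by rewrite rX0; [exact: blend_in_JA|exact/JAX/blend_in_JA].
have [rho rho0 h] := rXu _ eps0; have [rho' rho'0 h'] := blend_unif rho0.
exists (Num.min rho' (rho / 2)); first by rewrite lt_min rho'0 divr_gt0.
move=> w w' cw cw' ww1 ww2; apply: h; [exact: cX|exact: cX| |].
  apply: h'; [exact: sub|exact: sub| |].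
    by apply: uclose_le ww1; rewrite ge_min lexx.
  by apply: le_trans ww2 _; rewrite ge_min lexx.
have {}ww1 : uclose (rho / 2) w.1 w'.1.
  by apply: uclose_le ww1; rewrite ge_min lexx orbT.
have {}ww2 : `|w.2 - w'.2| <= rho / 2.
  by apply: le_trans ww2 _; rewrite ge_min lexx orbT.
have r2 : 0 <= rho / 2 by rewrite ltW// divr_gt0.
have h1 := blend_height_diff r2 ww1 ww2.
have h2 : blend_height w' <= blend_height w + 2 * (rho / 2).
  by apply: blend_height_diff => //; [exact: uclose_sym|rewrite distrC].
rewrite /= ler_norml; apply/andP; lra.
Qed.

End Blend.

Let blend_height_lt w k : 0 < k -> w.2 < k -> blend_height w < k.
Proof. by move=> k0 wk; rewrite gt_max k0 gt_min wk. Qed.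

(** Functions with values in the unit interval are within 1 of each other, hence
    all points of positive height less than 2 are in the domains of [rA] and
    [rX]. *)
Lemma pair_retraction_global rA rX : JA !=set0 ->
  collar_retraction JA 2 rA -> collar_retraction JX 2 rX ->
  exists r, pair_retraction 2 r.
Proof.
move=> [a Ja] rAP rXP.
have two0 : (0 : R) < 2 by lra.
have cA w : collar JX 2 w -> 0 < w.2 -> dist_to JA w.1 < 2 * w.2 ->
    collar JA 2 w.
  move=> [[w01 _ _] w2 _] w0 _; split=> //.
    by split=> // [|h]; [exact: ltW|move: w0; rewrite h ltxx].
  exists a => //; apply: (@uclose_le _ _ 1); first by lra.
  by apply: uclose_unit_valued => //; exact/JX01/JAX.
eexists; apply: (pair_retraction_blend two0 rAP rXP cA (lexx _)).
move=> w cw; have [_ w2 [p Jp _]] := cw; split.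
  exact: blend_height_lt.
exists p => //; apply: (@uclose_le _ _ 1); first by lra.
apply: uclose_unit_valued; last exact: JX01.
exact: (blend_unit_valued rAP cA).
Qed.

(** On a thin enough collar, the points of positive weight are near [JA], and
    the blend stays near [JX] by [blend_close]. *)
Lemma pair_retraction_local kA kX rA rX : 0 < kA -> 0 < kX ->
  collar_retraction JA kA rA -> collar_retraction JX kX rX ->
  exists2 k, 0 < k & exists r, pair_retraction k r.
Proof.
move=> kA0 kX0 rAP rXP.
(* The bound 1/2 keeps twice the height below the cap in [dist_to]. *)
pose k1 : R := Num.min (1 / 2) (kA / 2).
have k10 : 0 < k1 by rewrite lt_min !divr_gt0.
have cA w : collar JX k1 w -> 0 < w.2 -> dist_to JA w.1 < 2 * w.2 ->
    collar JA kA w.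
  move=> [[w01 _ _] + _] w0 D2; rewrite lt_min => /andP[w2 wA].
  have [|v v0 [[a Ja wa] vt]] := cinf_lt _ D2; first by lra.
  split; [|by lra|by exists a => //; apply: uclose_le wa; lra].
  by split=> // [|h]; [exact: ltW|move: w0; rewrite h ltxx].
have kX2 : 0 < kX / 2 by rewrite divr_gt0.
have [t0 t00 near] := blend_close kA0 rAP cA kX2.
pose k := Num.min k1 (Num.min t0 (kX / 2)).
have kp : 0 < Num.min t0 (kX / 2) by rewrite lt_min t00.
exists k; first by rewrite lt_min k10.
eexists; apply: (pair_retraction_blend kA0 rAP rXP cA (k' := k)).
  by rewrite ge_min lexx.
move=> w cw; have [pw + [p Jp wp]] := cw; rewrite lt_min => /andP[w1].
rewrite lt_min => /andP[wt wX].
have kkX : k <= kX / 2 by rewrite !ge_min lexx !orbT.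
split; first by apply: blend_height_lt => //; lra.
exists p => //; have c1 : collar JX k1 w.
  split=> //; exists p => //; apply: uclose_le wp.
  by rewrite ge_min lexx.
apply: uclose_le (uclose_trans (near w c1 wt) wp); lra.
Qed.

End PairRetraction.

(** * The space of maps of pairs *)

Section PairSpace.
Context {R : realType} {Y X : uniformType} (B : set Y) (A : set X).
Variables (dX : X -> X -> R) (dY : Y -> Y -> R).
Hypotheses (dXM : metrizes dX) (dX1 : forall x x', dX x x' <= 1).
Hypothesis dYM : metrizes dY.

Let U := unif_pair_space B A.
Let app (s : U) : Y -> X := set_val s.

Let dXP := metrizes_pseudo_metric dXM.
Let dYP := metrizes_pseudo_metric dYM.
Let dX0 := pseudo_metric_ge0 dXP.

Let dU (f g : U) := sup (range (fun y : Y => dX (app f y) (app g y))).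

Let dUM : metrizes dU.
Proof. exact: (@unif_pair_space_sup_metric R Y X B A dX 1 dXM dX1). Qed.

Let dX_le_dU f g y : dX (app f y) (app g y) <= dU f g.
Proof. by apply: ub_le_sup; [exists 1 => _ [y' _ <-]|exists y]. Qed.

Let dU_le f g c : 0 <= c -> (forall y, dX (app f y) (app g y) <= c) ->
  dU f g <= c.
Proof.
move=> c0 h; rewrite /dU.
have [->|/set0P ne] := eqVneq (range (fun y : Y => dX (app f y) (app g y))) set0.
  by rewrite sup0.
by apply: ge_sup => // _ [y _ <-].
Qed.

Let dU1 f g : dU f g <= 1.
Proof. exact: dU_le. Qed.

(** The map [x |-> dX x] is the Kuratowski embedding of [X]. *)
Lemma kuratowski_unit_valued x : unit_valued (dX x).
Proof. by move=> x'; rewrite dX0 dX1. Qed.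

Lemma kuratowski_uclose x x' : uclose (dX x x') (dX x) (dX x').
Proof.
have [_ dC dT] := dXP; apply/ucloseP => z.
by have := dT x x' z; have := dT x' x z; rewrite (dC x' x); lra.
Qed.

Lemma uclose_kuratowski x x' c : uclose c (dX x) (dX x') -> dX x x' <= c.
Proof.
by have [dd _ _] := dXP; move=> /(_ x'); rewrite dd subr0 ger0_norm.
Qed.

Let kuratowski_inj : injective dX.
Proof.
have [dd sep _ _ _] := dXM.
by move=> x x' xx'; apply: sep; rewrite xx' dd.
Qed.

Let app_unif s : unif_continuous (app s).
Proof. by have [] := set_valP s. Qed.

Let app_pair s y : B y -> A (app s y).
Proof. by move=> By; have [_ h] := set_valP s; apply: h; exists y. Qed.

(** Given a closed embedding [i] of the space of maps into [Z], a point [z] is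
    sent to the map [y |-> r (G z y, height z)], where [G] extends the evaluation
    and [height] is the distance to the image of [i]. *)
Section Assembly.
Variables (k : R) (r : (X -> R) * R -> X -> R).
Hypothesis rP : pair_retraction (range dX) (dX @` A) k r.
Variables (Z : uniformType) (i : U -> Z) (d : Z -> Z -> R).
Hypothesis i_emb : uniform_embedding i.
Hypothesis i_closed : closed (range i).
Hypothesis dM : metrizes d.
Hypothesis dU_le_d : forall s s', dU s s' <= d (i s) (i s').

Let dP := metrizes_pseudo_metric dM.
Let d0 := pseudo_metric_ge0 dP.
(* The factor makes [G], defined with [d], nonexpanding for [dZ]. *)
Let dZ z z' := 3 * d z z'.
Let three0 : (0 : R) < 3. Proof. by []. Qed.
Let dZM : metrizes dZ := metrizes_scale three0 dM.
Let dZ0 z z' : 0 <= dZ z z'. Proof. by rewrite mulr_ge0. Qed.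

Let ev (s : U) (y : Y) : X -> R := dX (app s y).

Let ev01 s y x : 0 <= ev s y x <= 1.
Proof. exact: kuratowski_unit_valued. Qed.

Let ev_lip s s' y : uclose (d (i s) (i s')) (ev s y) (ev s' y).
Proof.
apply: uclose_le (kuratowski_uclose _ _).
exact: le_trans (dX_le_dU _ _ _) (dU_le_d _ _).
Qed.

Let ev_unif s e : 0 < e ->
  exists2 rho, 0 < rho & forall y y', dY y y' < rho -> uclose e (ev s y) (ev s y').
Proof.
move=> e0; have /(unif_continuous_metricP _ dYM dXM)/(_ _ e0)[rho rho0 h] := app_unif s.
exists rho => // y y' /h yy'.
exact: uclose_le (ltW yy') (kuratowski_uclose _ _).
Qed.

Let G := extension dY d i ev.

Let G_lip z z' y : uclose (dZ z z') (G z y) (G z' y).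
Proof. exact: extension_lip. Qed.

Let G_ext s y : G (i s) y = dX (app s y).
Proof. exact: extension_extends. Qed.

Let height z : R := cinf [set v | exists s, v = dZ z (i s)].

Let height_lip z z' : `|height z - height z'| <= dZ z z'.
Proof.
have [_ _ dC dT _] := dZM.
have H w w' : height w' <= height w + dZ w w'.
  apply: cinf_shift => // v _ [s ->]; exists (dZ w' (i s)) => //.
  by split; [exists s|rewrite addrC (dC w)].
by rewrite ler_distlC; have := H z z'; have := H z' z; rewrite (dC z'); lra.
Qed.

Let height0 z : height z = 0 -> exists s, z = i s.
Proof.
move=> z0; suff [s _ <-] : range i z by exists s.
apply: (closed_metric dZM i_closed) => e e0.
have [||v _ [[s ->] vs]] := @cinf_lt _ [set v | exists s, v = dZ z (i s)] (Num.min 1 e).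
- by rewrite ge_min lexx.
- by rewrite -/(height z) z0 lt_min ltr01.
exists (i s); first by exists s.
by move: vs; rewrite lt_min => /andP[].
Qed.

Let height_base s : height (i s) = 0.
Proof.
apply/eqP; rewrite eq_le cinf_ge0 andbT; apply: cinf_le => //; exists s.
by have [dd _ _ _ _] := dZM; rewrite dd.
Qed.

(** The points over which [(G z y, height z)] stays in the collar of width [k],
    for every [y]: all points if [k > 1], since distances between functions and
    heights are at most 1. *)
Definition covered z := exists s : U, 1 < k \/ 3 * d z (i s) < k.

Let G_collar z y : covered z -> collar (range dX) k (G z y, height z).
Proof.
move=> [s cov]; split=> /=.
- split=> /=; [by move=> x; exact: extension01|exact: cinf_ge0|].
  by move=> /height0[s' ->]; rewrite G_ext; exists (app s' y).
- case: cov => [k1|h]; first exact: le_lt_trans (cinf_le1 _) k1.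
  by apply: le_lt_trans h; apply: cinf_le; [exact: dZ0|exists s].
exists (dX (app s y)); first by exists (app s y).
case: cov => [k1|h]; last by rewrite -G_ext; exact: uclose_le (ltW h) (G_lip _ _ _).
apply: (@uclose_le _ _ 1); first exact: ltW.
apply: uclose_unit_valued; last exact: kuratowski_unit_valued.
by move=> x; exact: extension01.
Qed.

Let F z y := r (G z y, height z).

Let F_base s y : F (i s) y = dX (app s y).
Proof. by rewrite /F height_base G_ext; case: rP => _ h _ _; rewrite h. Qed.

Let value_ex z y : covered z -> exists x, dX x = F z y.
Proof.
by move=> /(G_collar y) c; case: rP => h _ _ _; have [x _ xE] := h _ c; exists x.
Qed.

Let value z y (c : covered z) : X := sval (cid (value_ex y c)).

Let valueE z y (c : covered z) : dX (value y c) = F z y.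
Proof. exact: svalP (cid (value_ex y c)). Qed.

Let value_uclose z z' y y' (c : covered z) (c' : covered z') e :
  uclose e (F z y) (F z' y') -> dX (value y c) (value y' c') <= e.
Proof. by move=> h; apply: uclose_kuratowski; rewrite !valueE. Qed.

Let value_unif z (c : covered z) : unif_continuous (fun y => value y c).
Proof.
apply/(unif_continuous_metricP _ dYM dXM) => e e0.
have e2 : 0 < e / 2 by rewrite divr_gt0.
have [_ _ _ /(_ _ e2)[rho rho0 h]] := rP.
have [rho' rho'0 h'] := extension_unif i dYP dP ev01 z rho0.
exists rho' => // y y' /h' yy'; apply: (@le_lt_trans _ _ (e / 2)); last by lra.
apply: value_uclose.
apply: h; [exact: G_collar|exact: G_collar|exact: yy'|].
by rewrite subrr normr0 ltW.
Qed.

(* For [y] in [B] and any [s], [G z y] is within [dZ z (i s)] of the point of [A]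
   given by [s y]; so [(G z y, height z)] is in the cone over [A]. *)
Let value_pair z y (c : covered z) : B y -> A (value y c).
Proof.
move=> By; have [z0|z0] := eqVneq (height z) 0.
  have [s zs] := height0 z0; suff -> : value y c = app s y by exact: app_pair.
  by apply: kuratowski_inj; rewrite valueE zs F_base.
suff [a Aa aE] : (dX @` A) (F z y).
  by have -> : value y c = a by apply: kuratowski_inj; rewrite valueE.
have [_ _ h _] := rP; apply: h; first exact: G_collar.
  by rewrite lt_def z0 cinf_ge0.
apply: cinf_ge => [|v _ [s ->]]; first exact: cinf_le1.
apply: cinf_le => //; exists (dX (app s y)).
  by exists (app s y) => //; exact: app_pair.
by rewrite -G_ext; exact: G_lip.
Qed.

Let retract_subproof z (c : covered z) :
  unif_pair_maps B A ((fun y => value y c) : {uniform Y -> X}).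
Proof. by split; [exact: value_unif|move=> _ [y By <-]; exact: value_pair]. Qed.

Let retract z (c : covered z) : U := SigSub (mem_set (retract_subproof c)).

Let retract_app z (c : covered z) y : app (retract c) y = value y c.
Proof. by []. Qed.

Let retract_base z (c : covered z) s : z = i s -> retract c = s.
Proof.
move=> zs; apply: val_inj; apply/funext => y.
apply: kuratowski_inj; rewrite -[RHS](F_base s y) -zs; exact: valueE.
Qed.

Let retract_unif e : 0 < e -> exists2 rho, 0 < rho &
  forall z z' (c : covered z) (c' : covered z'), dZ z z' < rho ->
    dU (retract c) (retract c') <= e.
Proof.
move=> e0; have [_ _ _ /(_ _ e0)[rho rho0 h]] := rP.
exists rho => // z z' c c' zz'; apply: dU_le => [|y]; first exact: ltW.
rewrite !retract_app; apply: value_uclose.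
apply: h; [exact: G_collar|exact: G_collar| |].
  exact: uclose_le (ltW zz') (G_lip _ _ _).
exact: le_trans (height_lip _ _) (ltW zz').
Qed.

Lemma retraction_on_covered (N : set Z) : N `<=` covered ->
  exists rN : N -> range i, unif_continuous rN /\
    forall (x : N) (s : range i), set_val x = set_val s -> rN x = s.
Proof.
move=> Ncov; have [i_inj iu _] := i_emb.
have cov (x : N) : covered (set_val x) by apply: Ncov; exact: set_valP.
have mem (x : N) : range i (i (retract (cov x))) by exists (retract (cov x)).
exists (fun x => SigSub (mem_set (mem x))); split.
  apply/(unif_continuous_metricP _ (metrizes_set_type _ dZM)
    (metrizes_set_type _ dZM)) => e e0.
  have /(unif_continuous_metricP _ dUM dZM)/(_ _ e0)[rho rho0 h] := iu.
  have rho2 : 0 < rho / 2 by rewrite divr_gt0.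
  have [rho' rho'0 h'] := retract_unif rho2.
  exists rho' => // x x' xx'; apply: h.
  by apply: le_lt_trans (h' _ _ _ _ xx') _; lra.
move=> x s xs; apply: val_inj => /=; have [p _ ps] := set_valP s.
rewrite (@retract_base _ (cov x) p); first exact: ps.
by rewrite xs; exact/esym/ps.
Qed.

End Assembly.

(* A metric of [Z] for which the inverse of [i] does not expand. *)
Let embedding_metric (Z : uniformType) (i : U -> Z) :
  metrizable R Z -> uniform_embedding i ->
  exists2 d : Z -> Z -> R, metrizes d & forall s s', dU s s' <= d (i s) (i s').
Proof.
move=> [d0 d0M] [i_inj _ [g [gu gE]]]; apply: (remetrize d0M dU1) => e e0.
have /(unif_continuous_metricP _ (metrizes_set_type _ d0M) dUM)/(_ _ e0)[rho rho0 h] := gu.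
exists rho => // s s' ss'.
have m t : range i (i t) by exists t.
have gi t : g (SigSub (mem_set (m t))) = t by apply: i_inj; rewrite gE.
by rewrite -(gi s) -(gi s') ltW// h.
Qed.

(** The first argument is any map of pairs: over an empty space of maps there
    is nothing to retract onto. *)
Lemma pair_space_AR r : U -> pair_retraction (range dX) (dX @` A) 2 r ->
  uniform_AR R U.
Proof.
move=> u rP; split=> [|Z i ZM ie ic]; first by exists dU.
have [d dM dUd] := embedding_metric ZM ie.
have [|rN [rNu rNE]] := retraction_on_covered rP ie ic dM dUd (N := setT).
  by move=> z _; exists u; left; lra.
have inT (z : Z) : [set: Z] z by [].
exists (fun z => rN (SigSub (mem_set (inT z)))); split; last by move=> s; exact: rNE.
have SM := metrizes_set_type _ dM.
apply/(unif_continuous_metricP _ dM (SM _)) => e e0.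
have /(unif_continuous_metricP _ (SM _) (SM _))/(_ _ e0)[rho rho0 h] := rNu.
by exists rho => // z z' zz'; exact: h.
Qed.

Lemma pair_space_ANR k r : 0 < k -> pair_retraction (range dX) (dX @` A) k r ->
  uniform_ANR R U.
Proof.
move=> k0 rP; split=> [|Z i ZM ie ic]; first by exists dU.
have [d dM dUd] := embedding_metric ZM ie.
exists [set z | exists s, 3 * d z (i s) < k]; split.
  exists d => //; exists (k / 3); first by rewrite divr_gt0.
  move=> _ z [s _ <-] sz; exists s; have [_ _ dC _ _] := dM.
  by rewrite (dC z); lra.
apply: (retraction_on_covered rP ie ic dM dUd) => z [s zs].
by exists s; right.
Qed.

End PairSpace.

(** A one-point space does not retract onto an empty closed subspace. *)
Lemma uniform_AR_inhabited (R : realType) (P : uniformType) :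
  uniform_AR R P -> inhabited P.
Proof.
move=> [[d dM] AR]; apply: contrapT => Ph.
have no (p : P) : False by apply: Ph.
have oneP : pseudo_metric (fun _ _ : unit => 0 : R).
  by split=> // *; rewrite addr0.
pose i (a : P) : metric_space oneP := False_rect _ (no a).
have nor (z : range i) : False by have [a] := set_valP z; case: (no a).
have [|||r _] := AR (metric_space oneP) i.
- by exists (fun _ _ => 0); apply: metric_space_metrizes => -[] [].
- split=> [a|V _|]; first by case: (no a).
    by apply: filterS (@filterT _ entourage _) => xy; case: (no xy.1).
  exists (fun z => False_rect _ (nor z)); split=> [V _|z]; last by case: (nor z).
  by apply: filterS (@filterT _ entourage _) => xy; case: (nor xy.1).
- by move=> z clz; have [w [[a _ _] _]] := clz setT filterT; case: (no a).
exact: nor (r tt).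
Qed.

Lemma const_pair_map (Y X : uniformType) (B : set Y) (A : set X) a :
  A a -> unif_pair_space B A.
Proof.
move=> Aa; have h : unif_pair_maps B A ((fun=> a) : {uniform Y -> X}).
  split=> [V EV|_ [y _ <-]//].
  by apply: filterS (@filterT _ entourage _) => xy _; exact: entourage_refl.
exact: SigSub (mem_set h).
Qed.

Theorem theorem14p4 (R : realType) (Y X : uniformType) (B : set Y) (A : set X)
    (hY : metrizable R Y) :
  (uniform_AR R X -> uniform_AR R (set_type A) ->
    uniform_AR R (unif_pair_space B A)) /\
  (uniform_ANR R X -> uniform_ANR R (set_type A) ->
    uniform_ANR R (unif_pair_space B A)).
Proof.
have [dY dYM] := hY.
have bounded : metrizable R X -> exists2 dX : X -> X -> R, metrizes dX &
    forall x x', dX x x' <= 1.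
  move=> [d dM]; exists (fun x x' => Num.min 1 (d x x')).
    exact: metrizes_min1.
  by move=> x x'; rewrite ge_min lexx.
have rangeA (dX : X -> X -> R) :
    range (fun a : set_type A => dX (set_val a)) = dX @` A.
  apply/seteqP; split=> e [a].
    by move=> _ <-; exists (set_val a) => //; exact: set_valP.
  by move=> Aa <-; exists (SigSub (mem_set Aa)).
have sub (dX : X -> X -> R) : dX @` A `<=` range dX.
  by move=> _ [a _ <-]; exists a.
have JX01 (dX : X -> X -> R) : metrizes dX -> (forall x x', dX x x' <= 1) ->
    forall e, range dX e -> unit_valued e.
  by move=> dXM dX1 _ [x _ <-]; exact: kuratowski_unit_valued.
split=> hX hA; have [/bounded[dX dXM dX1] _] := hX.
- have two0 : (0 : R) < 2 by [].
  have [rX rXP] := uniform_AR_collar dXM (kuratowski_unit_valued dXM dX1)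
    (kuratowski_uclose dXM) (uclose_kuratowski dXM) hX two0.
  have [rA] := uniform_AR_collar (metrizes_set_type A dXM)
    (fun a => kuratowski_unit_valued dXM dX1 (set_val a))
    (fun a b => kuratowski_uclose dXM (set_val a) (set_val b))
    (fun a b => uclose_kuratowski dXM (x := set_val a) (x' := set_val b))
    hA two0.
  rewrite rangeA => rAP; have [a] := uniform_AR_inhabited hA.
  have ne : dX @` A !=set0 by exists (dX (set_val a)), (set_val a) => //; exact: set_valP.
  have [r rP] := pair_retraction_global (sub dX) (JX01 _ dXM dX1) ne rAP rXP.
  exact: (pair_space_AR dXM dX1 dYM (const_pair_map B (set_valP a)) rP).
have [kX kX0 [rX rXP]] := uniform_ANR_collar dXM (kuratowski_unit_valued dXM dX1)
  (kuratowski_uclose dXM) (uclose_kuratowski dXM) hX.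
have [kA kA0 [rA]] := uniform_ANR_collar (metrizes_set_type A dXM)
  (fun a => kuratowski_unit_valued dXM dX1 (set_val a))
  (fun a b => kuratowski_uclose dXM (set_val a) (set_val b))
  (fun a b => uclose_kuratowski dXM (x := set_val a) (x' := set_val b)) hA.
rewrite rangeA => rAP.
have [k k0 [r rP]] :=
  pair_retraction_local (sub dX) (JX01 _ dXM dX1) kA0 kX0 rAP rXP.
exact: (pair_space_ANR B dXM dX1 dYM k0 rP).
Qed.
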